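(* Let $n,k$ be integers with $1\le k\le n$. Then \[ \sum_{i=0}^{\lfloor \frac{k-1}2 \rfloor}\binom{2k-2i-1}{k}\binom{2n+1}{2i+1}B_{2n-2i} =(-1)^k2^{2k-2n}\sum_{i=0}^{n-k}\binom{n-i}{k}\binom{2n+1}{2i}(2^{2i-1}-1)B_{2i}. \]
   Context: $B_m$ are the Bernoulli numbers defined by $x/(e^x-1)=\sum_{m\ge0}B_m x^m/m!$ (so $B_0=1$, $B_2=1/6$). *)

(* Defs.v *)
From HB Require Import structures.
From mathcomp Require Import all_boot all_order all_algebra.

Set Implicit Arguments.
Unset Strict Implicit.
Unset Printing Implicit Defensive.

Import Order.TTheory GRing.Theory Num.Theory.
Local Open Scope ring_scope.

(* A formal power series over the rationals is the sequence f : nat -> rat of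
   its coefficients, f m being the coefficient of x^m. *)
Definition fps_mul (f g : nat -> rat) (m : nat) : rat :=
  \sum_(i < m.+1) f i * g (m - i)%N.

Definition fps_x (m : nat) : rat := (m == 1%N)%:R.

(* e^x - 1 = \sum_(m >= 1) x^m / m! *)
Definition fps_expm1 (m : nat) : rat := if m == 0%N then 0 else (m`!%:R)^-1.

(* \sum_(m >= 0) B_m x^m / m! *)
Definition egf (B : nat -> rat) (m : nat) : rat := B m / m`!%:R.

(* x / (e^x - 1) = \sum_(m >= 0) B_m x^m / m!, with the denominator cleared;
   the quotient is well defined because e^x - 1 is a nonzero series, and
   bernoulli_numbers_exists and bernoulli_numbers_unique show that exactly one
   sequence satisfies this. *)
Definition bernoulli_numbers (B : nat -> rat) : Prop :=
  fps_mul fps_expm1 (egf B) =1 fps_x.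

Lemma factr_neq0 (m : nat) : m`!%:R != 0 :> rat.
Proof. by rewrite pnatr_eq0 -lt0n fact_gt0. Qed.

Lemma fps_mul_expm1S (B : nat -> rat) (m : nat) :
  fps_mul fps_expm1 (egf B) m.+1 =
  egf B m + \sum_(i < m) (i.+2`!%:R)^-1 * egf B (m - i.+1)%N.
Proof.
rewrite /fps_mul big_ord_recl mul0r add0r big_ord_recl.
by rewrite /fps_expm1 /= /bump /= invr1 mul1r subSS subn0.
Qed.

Lemma bernoulli_numbers_unique (B C : nat -> rat) :
  bernoulli_numbers B -> bernoulli_numbers C -> B =1 C.
Proof.
move=> hB hC m; elim/ltn_ind: m => m IH.
have := hB m.+1; rewrite -(hC m.+1) !fps_mul_expm1S.
rewrite (eq_bigr (fun i : 'I_m => (i.+2`!%:R)^-1 * egf C (m - i.+1)%N)); last first.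
  by move=> i _; rewrite /egf IH // ltn_subrL /=; case: m i {IH} => [[]|].
by move/addIr/(mulIf (invr_neq0 (factr_neq0 m))).
Qed.

Lemma bernoulli_numbers_exists : exists B : nat -> rat, bernoulli_numbers B.
Proof.
pose fix s (n : nat) : seq rat := if n is m.+1 then
  ((m == 0%N)%:R - \sum_(i < m) (i.+2`!%:R)^-1 * (s m)`_i) :: s m else [::].
pose b m := (s m.+1)`_0.
have sE n i : (i < n)%N -> (s n)`_i = b (n - i.+1)%N.
  elim: n i => // n IH [|i] lt_in; first by rewrite subn1.
  by rewrite subSS -IH.
exists (fun m => b m * m`!%:R) => -[|m].
  by rewrite /fps_mul big_ord1 mul0r.
have eE j : egf (fun m => b m * m`!%:R) j = b j by rewrite /egf mulfK ?factr_neq0.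
rewrite fps_mul_expm1S eE {1}/b /= (eq_bigr (fun i : 'I_m =>
    (i.+2`!%:R)^-1 * egf (fun m => b m * m`!%:R) (m - i.+1)%N)); last first.
  by move=> i _; rewrite eE sE.
by rewrite subrK.
Qed.

(* Main.v *)
Require Import Defs.
From HB Require Import structures.
From mathcomp Require Import all_boot all_order all_algebra.
From mathcomp Require Import zify ring lra.

Set Implicit Arguments.
Unset Strict Implicit.
Unset Printing Implicit Defensive.

Import Order.TTheory GRing.Theory Num.Theory.
Local Open Scope ring_scope.

(* Let N = 2n+1 and v = x (1 - x).  Since B_N(x) is odd about x = 1/2, it is
   (1 - 2x) times a polynomial in v (Faulhaber), and both sides of the identity
   are the coefficient of v^k in that polynomial.  Substituting x = v C(v), C the
   Catalan series, into B_N(x) = \sum_j 'C(N, j) B_(N-j) x^j gives the left side.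
   Expanding B_N around 1/2, where B_i(1/2) = (2^(1-i) - 1) B_i, and using
   (x - 1/2)^2 = 1/4 - v gives the right side.  The values at 1/2 come from the
   umbral functional 'X^m |-> B_m, which is determined by its values
   p'(0) on the differences p(X + 1) - p(X). *)

(** * Linear functionals on polynomials and the Bernoulli umbra *)

Lemma scalar_poly_ext (F G : {scalar {poly rat}}) :
  (forall m, F 'X^m = G 'X^m) -> F =1 G.
Proof.
move=> FG p; rewrite -[p]coefK poly_def !linear_sum.
by apply: eq_bigr => i _; rewrite !linearZ FG.
Qed.

(** [('X + 1)^(m+1) - 'X^(m+1)] is [(m+1) 'X^m] plus lower powers, on which [F] vanishes by
    induction. *)
Lemma scalar_difference_eq0 (F : {scalar {poly rat}}) :
  (forall p, F (p \Po ('X + 1)) = F p) -> forall p, F p = 0.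
Proof.
move=> hF; apply: (@scalar_poly_ext F (\0 : {scalar {poly rat}})) => m /=.
elim/ltn_ind: m => m IH.
have := hF 'X^(m.+1).
rewrite comp_Xn_poly addrC exprDn linear_sum !big_ord_recr /= subnn expr0 mul1r.
rewrite binn -[RHS]add0r => /addIr; rewrite expr1n mul1r linearMn big1 => [|i _].
  move/eqP; rewrite add0r binSn -mulr_natr mulf_eq0 pnatr_eq0 orbF.
  by move/eqP.
by rewrite expr1n mul1r linearMn IH // mul0rn.
Qed.

Definition umbral (B : nat -> rat) (p : {poly rat}) : rat :=
  \sum_(i < size p) p`_i * B i.

(** Summing up to any larger bound allows a common range for several polynomials, as linearity
    requires. *)
Lemma umbralE B d (p : {poly rat}) :
  (size p <= d)%N -> umbral B p = \sum_(i < d) p`_i * B i.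
Proof.
move=> le_pd; rewrite /umbral (big_ord_widen _ (fun i => p`_i * B i) le_pd).
rewrite big_mkcond; apply: eq_bigr => i _; case: ltnP => // le_pi.
by rewrite nth_default // mul0r.
Qed.

Fact umbral_is_scalar B : scalar (umbral B).
Proof.
move=> a p q; pose d := maxn (size p) (size q).
rewrite !(@umbralE B d) ?leq_maxl ?leq_maxr //; last first.
  rewrite (leq_trans (size_polyD _ _)) // geq_max leq_maxr andbT.
  by rewrite (leq_trans (size_scale_leq _ _)) // leq_maxl.
rewrite mulr_sumr -big_split; apply: eq_bigr => i _ /=.
by rewrite coefD coefZ mulrDl mulrA.
Qed.
HB.instance Definition _ B :=
  GRing.isLinear.Build rat {poly rat} rat *%R (umbral B) (umbral_is_scalar B).

Lemma umbralXn B m : umbral B 'X^m = B m.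
Proof.
rewrite /umbral size_polyXn (bigD1 ord_max) //= coefXn eqxx mul1r big1 ?addr0 //.
by move=> i; rewrite -val_eqE coefXn /= => /negbTE ->; rewrite mul0r.
Qed.

(** On ['X^m] this is [m!] times the coefficient of [x^m] in the defining relation of the Bernoulli
    numbers. *)
Lemma umbral_bernoulli_difference B : bernoulli_numbers B ->
  forall p, umbral B (p \Po ('X + 1)) = umbral B p + p`_1.
Proof.
move=> hB.
apply: (@scalar_poly_ext (umbral B \o comp_poly ('X + 1) : {scalar {poly rat}})
  ((umbral B : {scalar {poly rat}}) \+ coefp 1%N : {scalar {poly rat}})) => m /=.
rewrite comp_Xn_poly addrC exprDn linear_sum big_ord_recr /= addrC coefXn.
rewrite subnn expr0 mul1r binn; congr (_ + _).
have := congr1 ( *%R m`!%:R) (hB m).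
rewrite /fps_mul big_ord_recl mul0r add0r /fps_x eq_sym => hm.
transitivity (m`!%:R * (1%N == m)%:R : rat); last first.
  by case: eqP => [<-|]; rewrite ?mulr1 ?mulr0.
rewrite -hm mulr_sumr (reindex_inj rev_ord_inj); apply: eq_bigr => i _ /=.
have lt_im := ltn_ord i.
rewrite expr1n mul1r linearMn /= umbralXn /egf /fps_expm1 /bump /= add1n.
rewrite -mulr_natr -(@bin_fact m (m - i.+1)) ?leq_subr //.
have -> : (m - (m - i.+1) = i.+1)%N by lia.
move: (factr_neq0 (m - i.+1)) (factr_neq0 i.+1).
move: (m - i.+1)`! i.+1`! => x y nzx nzy; rewrite !natrM; field.
by rewrite nzx nzy.
Qed.

(** [F - c * umbral B] is invariant under the shift, hence zero. *)
Lemma umbral_bernoulli_unique B (F : {scalar {poly rat}}) (c : rat) :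
  bernoulli_numbers B ->
  (forall p, F (p \Po ('X + 1)) = F p + c * p`_1) ->
  forall p, F p = c * umbral B p.
Proof.
move=> hB hF p; apply/eqP; rewrite -subr_eq0; apply/eqP.
pose G : {scalar {poly rat}} := F \- (umbral B \o *:%R c).
have GE q : G q = F q - c * umbral B q by rewrite /G /= linearZ.
rewrite -GE; apply: scalar_difference_eq0 => q.
by rewrite !GE hF umbral_bernoulli_difference //; ring.
Qed.

(** Chain rule at 0: the linear coefficient of a polynomial is its derivative there. *)
Lemma coef1_comp_scale (a : rat) (p : {poly rat}) :
  (p \Po (a *: 'X))`_1 = a * p`_1.
Proof.
rewrite -[LHS](mulr1n (_`_1)) -coef_deriv deriv_comp derivZ derivX -!horner_coef0.
rewrite hornerM horner_comp !hornerE /= mulr1 mulrC horner_coef0 coef_deriv.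
by rewrite mulr1n.
Qed.

(** Shifting [p] turns [p(-1 - X)] into [p(-X)]; the difference rule for [p(-X)] shows that the
    value grows by [p'(0)]. *)
Lemma umbral_bernoulli_reflection B : bernoulli_numbers B ->
  forall p, umbral B (p \Po (- 1 - 'X)) = umbral B p.
Proof.
move=> hB p; rewrite -[RHS]mul1r.
apply: (@umbral_bernoulli_unique B
  (umbral B \o comp_poly (- 1 - 'X) : {scalar {poly rat}}) 1 hB) => {}p /=.
have := umbral_bernoulli_difference hB (p \Po (-1 *: 'X)).
rewrite coef1_comp_scale -!comp_polyA !(rmorphD, rmorphN, rmorph1, linearZ) /=.
rewrite !comp_polyX !scaleN1r !opprD [- 1 - 'X]addrC => ->.
by rewrite subrK; ring.
Qed.

(** Shifting [p] turns the pair [p(2X)], [p(2X + 1)] into [p(2X + 1)], [p(2X + 2)], so the sum grows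
    by the linear coefficient [2 p'(0)] of [p(2X)]. *)
Lemma umbral_bernoulli_duplication B : bernoulli_numbers B ->
  forall p, umbral B (p \Po (2%:R *: 'X)) + umbral B (p \Po (2%:R *: 'X + 1))
            = 2%:R * umbral B p.
Proof.
move=> hB p.
apply: (@umbral_bernoulli_unique B
  ((umbral B \o comp_poly (2%:R *: 'X)) \+ (umbral B \o comp_poly (2%:R *: 'X + 1))
    : {scalar {poly rat}}) 2%:R hB) => {}p /=.
have := umbral_bernoulli_difference hB (p \Po (2%:R *: 'X)).
rewrite coef1_comp_scale -!comp_polyA !(rmorphD, rmorphN, rmorph1, linearZ) /=.
rewrite !comp_polyX.
have -> : 2%:R *: ('X + 1) = 2%:R *: 'X + 1 + 1 :> {poly rat}.
  by rewrite scalerDr [_ *: 1]scaler_nat mulr2n addrA.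
by move=> ->; ring.
Qed.

(** The value at 1/2 of the Bernoulli polynomial of degree [i]. *)
Definition umbral_half B i := umbral B (('X + 2^-1%:P) ^+ i).

(** The reflection sends [X + 1/2] to its opposite. *)
Lemma umbral_half_odd B i : bernoulli_numbers B -> odd i -> umbral_half B i = 0.
Proof.
move=> hB odd_i; suff: umbral_half B i = - umbral_half B i by lra.
rewrite {1}/umbral_half -umbral_bernoulli_reflection // rmorphXn rmorphD /=.
rewrite comp_polyX comp_polyC.
have -> : -1 - 'X + 2^-1%:P = - ('X + 2^-1%:P) :> {poly rat}.
  have -> : -1 = - (2^-1 + 2^-1)%:P :> {poly rat} by [].
  by rewrite polyCD; ring.
by rewrite exprNn -signr_odd odd_i mulN1r linearN.
Qed.

(** Since [2X + 1 = 2(X + 1/2)], duplication on ['X^i] reads [2^i B_i + 2^i B_i(1/2) = 2 B_i]. *)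
Lemma umbral_halfE B i : bernoulli_numbers B ->
  umbral_half B i = (2%:R / 2%:R ^+ i - 1) * B i.
Proof.
move=> hB; have := umbral_bernoulli_duplication hB 'X^i.
rewrite !comp_Xn_poly umbralXn.
have -> : 2%:R *: 'X + 1 = 2%:R *: ('X + 2^-1%:P) :> {poly rat}.
  by rewrite scalerDr scale_polyC mulfV.
rewrite !exprZn !linearZ /= umbralXn -/(umbral_half B i) => dup.
apply: (@mulfI rat (2%:R ^+ i)); first by rewrite expf_neq0.
rewrite -[LHS](addKr (2%:R ^+ i * B i)) dup; field.
by rewrite expf_neq0.
Qed.

(** Compare the two preceding evaluations at 1/2; the factor [2 / 2^i - 1] vanishes only at
    [i = 1]. *)
Lemma bernoulli_odd_eq0 B i :
  bernoulli_numbers B -> odd i -> (1 < i)%N -> B i = 0.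
Proof.
move=> hB odd_i; have := umbral_half_odd hB odd_i.
rewrite umbral_halfE // => /eqP; rewrite mulf_eq0 => /orP[|/eqP//].
case: i {odd_i} => [|[|i]] //; rewrite subr_eq0 exprS invfM mulrA mulfV // mul1r.
by rewrite invr_eq1 pexpr_eq1.
Qed.

(** * Bernoulli polynomials and their expansion around 1/2 *)

Lemma poly_horner_inj (p q : {poly rat}) : (forall x, p.[x] = q.[x]) -> p = q.
Proof.
move=> pq; apply/eqP; rewrite -subr_eq0; apply/eqP.
apply: (@roots_geq_poly_eq0 rat _ [seq i%:R | i <- iota 0 (size (p - q))]).
- by apply/allP => _ /mapP[i _ ->]; rewrite rootE hornerD hornerN pq subrr.
- by rewrite map_inj_uniq ?iota_uniq // => i j /eqP; rewrite eqr_nat => /eqP.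
- by rewrite size_map size_iota.
Qed.

Definition bernoulli_poly (B : nat -> rat) N : {poly rat} :=
  \poly_(j < N.+1) ('C(N, j)%:R * B (N - j)%N).

Lemma horner_bernoulli_poly B N x :
  (bernoulli_poly B N).[x] = umbral B (('X + x%:P) ^+ N).
Proof.
rewrite horner_poly exprDn linear_sum; apply: eq_bigr => j _.
rewrite -polyC_exp [_ * _%:P]mulrC mul_polyC linearMn linearZ /= umbralXn.
by rewrite -mulr_natr; ring.
Qed.

(** Expand [((x - 1/2) + (X + 1/2))^N] under the umbral functional. *)
Lemma bernoulli_poly_center B N :
  bernoulli_poly B N =
  \sum_(i < N.+1) ('C(N, i)%:R * umbral_half B i) *: ('X - 2^-1%:P) ^+ (N - i).
Proof.
apply: poly_horner_inj => x; rewrite horner_bernoulli_poly.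
have -> : 'X + x%:P = (x - 2^-1)%:P + ('X + 2^-1%:P) :> {poly rat}.
  by rewrite polyCB; ring.
rewrite exprDn linear_sum horner_sum; apply: eq_bigr => i _.
rewrite -polyC_exp mul_polyC linearMn linearZ /= hornerZ horner_exp !hornerE.
by rewrite -mulr_natr /umbral_half; ring.
Qed.

(** * Parity splitting of sums, and coefficients in powers of [v = x (1 - x)] *)

Lemma sum_even_odd (V : nmodType) (f : nat -> V) n :
  \sum_(i < n.*2) f i = \sum_(i < n) (f i.*2 + f i.*2.+1).
Proof.
elim: n => [|n IH]; first by rewrite !big_ord0.
by rewrite doubleS !big_ord_recr /= IH addrA.
Qed.

(* The coefficient of v^k in p / (1 - 2x), where v = x (1 - x): if x = v C(v)
   with C the Catalan series, then
   x^j / (1 - 2x) = \sum_(k >= j) 'C(2k - j, k) v^k. *)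
Definition faulhaber_coef k (p : {poly rat}) : rat :=
  \sum_(j < k.+1) p`_j * 'C(k.*2 - j, k)%:R.

Fact faulhaber_coef_is_scalar k : scalar (faulhaber_coef k).
Proof.
move=> a p q; rewrite mulr_sumr -big_split; apply: eq_bigr => i _ /=.
by rewrite coefD coefZ mulrDl mulrA.
Qed.
HB.instance Definition _ k := GRing.isLinear.Build rat {poly rat} rat *%R
  (faulhaber_coef k) (faulhaber_coef_is_scalar k).

Lemma faulhaber_coefXM k (q : {poly rat}) :
  faulhaber_coef k.+1 ('X * q) = \sum_(j < k.+1) q`_j * 'C((k.*2 - j).+1, k.+1)%:R.
Proof.
rewrite /faulhaber_coef big_ord_recl coefXM mul0r add0r.
apply: eq_bigr => j _; rewrite coefXM /= /bump /= add1n; congr (_ * _%:R).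
by congr binomial; have := ltn_ord j; lia.
Qed.

(** Multiplication by [v] shifts the coefficients by one; termwise this is Pascal's rule. *)
Lemma faulhaber_coefSM k (q : {poly rat}) :
  faulhaber_coef k.+1 ('X * (1 - 'X) * q) = faulhaber_coef k q.
Proof.
have -> : 'X * (1 - 'X) * q = 'X * q - 'X * ('X * q) by ring.
rewrite linearB /= !faulhaber_coefXM.
rewrite [X in _ - X]big_ord_recl coefXM mul0r add0r.
have -> : \sum_(i < k) ('X * q)`_(lift ord0 i) * 'C((k.*2 - lift ord0 i).+1, k.+1)%:R
  = \sum_(j < k.+1) q`_j * 'C(k.*2 - j, k.+1)%:R.
  (* The added term [j = k] contains ['C(k, k+1) = 0]. *)
  rewrite [RHS]big_ord_recr /= [X in _ + X]mulrC bin_small ?mul0r ?addr0; last lia.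
  apply: eq_bigr => j _; rewrite coefXM /= /bump /= add1n; congr (_ * _%:R).
  by congr binomial; have := ltn_ord j; lia.
rewrite -sumrB; apply: eq_bigr => j _.
by rewrite binS natrD; ring.
Qed.

(** For positive index this is ['C(2k+2, k+1) = 2 'C(2k+1, k+1)], by Pascal's rule and symmetry. *)
Lemma faulhaber_coef_base k : faulhaber_coef k (1 - 2%:R *: 'X) = (k == 0)%:R.
Proof.
case: k => [|k].
  by rewrite /faulhaber_coef big_ord1 coefB coef1 coefZ coefX /= mulr0 subr0 mulr1.
rewrite /faulhaber_coef 2!big_ord_recl big1 => [|j _].
  rewrite !(coefB, coef1, coefZ, coefX) /= /bump /= doubleS subn0 subSS subn0.
  rewrite binS.
  have -> : 'C(k.*2.+1, k) = 'C(k.*2.+1, k.+1).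
    by rewrite -bin_sub; [congr binomial|]; lia.
  by rewrite natrD; ring.
by rewrite !(coefB, coef1, coefZ, coefX) /= /bump /= mulr0 subr0 mul0r.
Qed.

(** Justifies reading [faulhaber_coef k] as the coefficient of [v^k] on multiples of [1 - 2x] by
    polynomials in [v]. *)
Lemma faulhaber_coefP k m :
  faulhaber_coef k (('X * (1 - 'X)) ^+ m * (1 - 2%:R *: 'X)) = (k == m)%:R.
Proof.
elim: m k => [|m IH] [|k]; rewrite ?expr0 ?mul1r ?faulhaber_coef_base //.
  by rewrite /faulhaber_coef big_ord1 exprS -!mulrA coefXM mul0r.
by rewrite exprS -mulrA faulhaber_coefSM IH eqSS.
Qed.

(** The odd power equals [-1/2 (1/4 - v)^d (1 - 2x)]; the binomial theorem gives its coefficient of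
    [v^k]. *)
Lemma faulhaber_coef_center k d :
  faulhaber_coef k (('X - 2^-1%:P) ^+ d.*2.+1) =
  - 2^-1 * (-1) ^+ k * (4^-1) ^+ (d - k) * 'C(d, k)%:R.
Proof.
have -> : ('X - 2^-1%:P) ^+ d.*2.+1 = - 2^-1 *:
   ((4^-1%:P - 'X * (1 - 'X)) ^+ d * (1 - 2%:R *: 'X)) :> {poly rat}.
  rewrite exprS mulrC -mul2n exprM.
  have -> : ('X - 2^-1%:P) ^+ 2 = 4^-1%:P - 'X * (1 - 'X) :> {poly rat}.
    have -> : 4^-1 = 2^-1 * 2^-1 :> rat by [].
    have -> : 1 = (2^-1 + 2^-1)%:P :> {poly rat} by [].
    by rewrite polyCM polyCD; ring.
  rewrite scalerAr; congr (_ * _).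
  by rewrite scalerBr scalerA mulNr mulVf // scaleN1r opprK scaleNr addrC alg_polyC.
have termE i : faulhaber_coef k (4^-1%:P ^+ (d - i) * (- ('X * (1 - 'X))) ^+ i
     *+ 'C(d, i) * (1 - 2%:R *: 'X)) =
   (-1) ^+ i * 4^-1 ^+ (d - i) * 'C(d, i)%:R * (k == i)%:R.
  rewrite -faulhaber_coefP -linearZ /=; congr faulhaber_coef.
  rewrite (exprNn ('X * _)) -mulr_natr -!mul_polyC !polyCM polyC_natr.
  by rewrite !polyC_exp polyCN polyC1; ring.
rewrite linearZ /= exprDn mulr_suml linear_sum.
under eq_bigr do rewrite /= termE.
(* For [d < k] the exponent [d - k] truncates to 0, but ['C(d, k)] vanishes. *)
case: (ltnP d k) => [lt_dk|le_kd].
  rewrite (bin_small lt_dk) big1 ?mulr0 // => i _.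
  by rewrite gtn_eqF ?mulr0 // (leq_trans (ltn_ord i)).
rewrite (bigD1 (inord k)) //= inordK // eqxx big1 => [|i].
  by rewrite addr0 mulr1 !mulrA.
by rewrite -val_eqE /= inordK // eq_sym => /negbTE ->; rewrite mulr0.
Qed.

(** * The two evaluations of the coefficient of [v^k] *)

Theorem theorem4 (B : nat -> rat) (hB : bernoulli_numbers B)
    (n k : nat) (hk1 : (1 <= k)%N) (hkn : (k <= n)%N) :
  \sum_(0 <= i < ((k - 1) %/ 2).+1)
     'C(2 * k - 2 * i - 1, k)%:R * 'C(2 * n + 1, 2 * i + 1)%:R
       * B (2 * n - 2 * i)%N
  = (-1) ^+ k * (2%:Q ^ (2 * k%:Z - 2 * n%:Z)) *
    \sum_(0 <= i < (n - k).+1)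
      'C(n - i, k)%:R * 'C(2 * n + 1, 2 * i)%:R
        * (2%:Q ^ (2 * i%:Z - 1) - 1) * B (2 * i)%N.
Proof.
have lhsE : faulhaber_coef k (bernoulli_poly B n.*2.+1) =
  \sum_(0 <= i < ((k - 1) %/ 2).+1)
     'C(2 * k - 2 * i - 1, k)%:R * 'C(2 * n + 1, 2 * i + 1)%:R
       * B (2 * n - 2 * i)%N.
  pose f j : rat := 'C(n.*2.+1, j)%:R * B (n.*2.+1 - j)%N * 'C(k.*2 - j, k)%:R.
  (* [2k - j < k] holds even where the subtraction truncates to 0, because [k >= 1]. *)
  have f_gt j : (k < j)%N -> f j = 0.
    by move=> lt_kj; rewrite /f (@bin_small (k.*2 - j)) ?mulr0 //; lia.
  (* For [2i <= k <= n] the odd index [2n+1-2i] is at least [n+1 > 1], so [B_1] never occurs. *)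
  have f_even i : f i.*2 = 0.
    case: (ltnP k i.*2) => [/f_gt //|le_ik].
    by rewrite /f (bernoulli_odd_eq0 hB) ?mulr0 ?mul0r //; lia.
  (* Padding with zero terms gives an even number of summands, ready for pairing. *)
  transitivity (\sum_(0 <= j < k.+1.*2) f j).
    rewrite (@big_cat_nat _ _ _ k.+1) //=; last lia.
    rewrite [X in _ + X]big_nat [X in _ + X]big1 ?addr0 => [|j /andP[/f_gt //]].
    rewrite big_mkord; apply: eq_bigr => j _.
    have lt_jk := ltn_ord j; rewrite coef_poly ifT //; lia.
  rewrite big_mkord sum_even_odd -(big_mkord xpredT (fun i => f i.*2 + f i.*2.+1)).
  rewrite (@big_cat_nat _ _ _ ((k - 1) %/ 2).+1) //=; last lia.
  rewrite [X in _ + X]big_nat [X in _ + X]big1 ?addr0 => [|i /andP[lt_i _]]; last first.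
    by rewrite f_even f_gt ?addr0 //; lia.
  apply: eq_bigr => i _; rewrite f_even add0r /f subSS !mul2n !addn1 -doubleB.
  by rewrite subn1 mulrAC -mulrA mulrCA mulrA subnS; congr (_ * _ * _); rewrite doubleB.
(* The same coefficient is now computed from the expansion around 1/2, where only even [i]
   survive. *)
rewrite -lhsE bernoulli_poly_center linear_sum -doubleS.
rewrite (sum_even_odd (fun i => faulhaber_coef k
  (('C(n.*2.+1, i)%:R * umbral_half B i) *: ('X - 2^-1%:P) ^+ (n.*2.+1 - i)))).
pose g i : rat := 'C(n.*2.+1, i.*2)%:R * umbral_half B i.*2 *
  (- 2^-1 * (-1) ^+ k * 4^-1 ^+ (n - i - k) * 'C(n - i, k)%:R).
transitivity (\sum_(0 <= i < n.+1) g i).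
  rewrite big_mkord; apply: eq_bigr => i _; have lt_in := ltn_ord i.
  rewrite (@umbral_half_odd B i.*2.+1) //= ?odd_double // mulr0 scale0r linear0 addr0.
  rewrite /g linearZ /= -faulhaber_coef_center; congr (_ * faulhaber_coef k (_ ^+ _)).
  by lia.
(* Terms with [i > n - k] vanish since ['C(n - i, k) = 0]. *)
rewrite (@big_cat_nat _ _ _ (n - k).+1) //=; last lia.
rewrite [X in _ + X]big_nat [X in _ + X]big1 ?addr0 => [|i /andP[lt_i _]]; last first.
  by rewrite /g (@bin_small (n - i)) ?mulr0 //; lia.
have -> : 2%:Q ^ (2 * k%:Z - 2 * n%:Z) = 4^-1 ^+ (n - k).
  have -> : 2 * k%:Z - 2 * n%:Z = - (2 * (n - k))%N%:Z by lia.
  by rewrite -exprnN exprM exprVn.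
have pow2E i : 2%:Q ^ (2 * i%:Z - 1) = 4%:R ^+ i / 2%:R.
  by rewrite expfzDr // -[2 * i%:Z]/((2 * i)%N%:Z) -exprnP exprM.
rewrite mulr_sumr; apply: eq_big_nat => i /andP[_ lt_i].
(* The powers of 2 match because [-1/2 * 4^i * (2 / 4^i - 1) = 4^i / 2 - 1]. *)
rewrite pow2E /g umbral_halfE // -!mul2n -addn1 exprM.
have -> : (n - k = n - i - k + i)%N by lia.
rewrite exprD !exprVn.
have := @expf_neq0 rat 4%:R i isT; have := @expf_neq0 rat 4%:R (n - i - k) isT.
rewrite -[2%:R ^+ 2]/(4%:R : rat).
move: (4%:R ^+ i) (4%:R ^+ _) => x y nzy nzx.
field.
by rewrite nzx nzy.
Qed.
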